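(* Let $R$ be an augmented Noetherian semiperfect algebra with Jacobson radical $J$ and let $$\xi:\quad 0\to K\to M\to N\to 0$$ be a short exact sequence of finitely generated $R$-modules such that the minimal Horseshoe Lemma holds for $\xi$. Then: (1) If $M$ is a quasi-Koszul module, then so is $K$. (2) If $J^2\Omega^i(K)=\Omega^i(K)\cap J^2\Omega^i(M)$ for all $i\ge0$, then $N$ is a quasi-Koszul module provided that $K$ and $M$ are quasi-Koszul modules.
   Context: Modules are left modules. $R$ is an associative unital algebra over a field. Semiperfect means every finitely generated $R$-module has a (finitely generated) projective cover. Augmented means that the canonical projection $R\to R/J$ is split by an algebra homomorphism $R/J\to R$. A projective resolution $\cdots\to P_1\xrightarrow{d_1}P_0\xrightarrow{d_0}X\to 0$ is minimal if $P_0\to X$ and each $P_n\to \ker d_{n-1}$ ($n\ge1$) are projective covers. The syzygies are $\Omega^0(X)=X$ and $\Omega^{i}(X)=\ker d_{i-1}\subseteq P_{i-1}$ for $i\ge1$. A finitely generated $R$-module $X$ is quasi-Koszul if, for a minimal projective resolution $\cdots\to P_1\xrightarrow{d_1}P_0\xrightarrow{d_0}X\to 0$ of $X$, $\ker d_n\subseteq JP_n$ and $J\ker d_n=\ker d_n\cap J^2P_n$ for all $n\ge0$. The minimal Horseshoe Lemma holds for $\xi: 0\to K\to M\to N\to0$ if for any given minimal projective resolutions $\mathcal{P}_*\to K\to0$ and $\mathcal{Q}_*\to N\to0$ there are a minimal projective resolution $\mathcal{L}_*\to M\to 0$ and a short exact sequence of complexes $0\to\mathcal{P}_*\to\mathcal{L}_*\to\mathcal{Q}_*\to0$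 such that the resulting diagram over $\xi$ (with the augmentations to $K$, $M$, $N$) is commutative with exact rows and columns. Fixing such a diagram, it induces short exact sequences $0\to\Omega^i(K)\to\Omega^i(M)\to\Omega^i(N)\to0$ for all $i\ge0$, by which $\Omega^i(K)$ is regarded as a submodule of $\Omega^i(M)$; this is the meaning of the intersection in (2). *)

(* Defs.v *)
From mathcomp Require Export all_boot all_algebra.
From mathcomp Require Export boolp classical_sets.

Set Implicit Arguments.
Unset Strict Implicit.
Unset Printing Implicit Defensive.

Import GRing.Theory.
Local Open Scope classical_set_scope.
Local Open Scope ring_scope.

(* Modules are left modules, and submodules are sets of elements.  Left ideals
   of R are submodules of the regular module R^o. *)

Section Modules.
Context {R : pzRingType}.
Implicit Types V W : lmodType R.

Definition submodule V (A : set V) : Prop := GRing.submod_closed (mem A).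

Definition kernel (T : Type) (W : zmodType) (f : T -> W) : set T := [set v | f v = 0].

Definition sub_fingen V (A : set V) : Prop :=
  exists (n : nat) (g : 'I_n -> V),
    A = [set v | exists c : 'I_n -> R, v = \sum_(i < n) c i *: g i].

Definition fingen V : Prop := sub_fingen [set: V].

Definition mulIM V (I : set R^o) (A : set V) : set V :=
  [set v | exists (n : nat) (a : 'I_n -> R) (x : 'I_n -> V),
     (forall i, I (a i)) /\ (forall i, A (x i)) /\
     v = \sum_(i < n) a i *: x i].

Definition maximal_submodule V (A : set V) : Prop :=
  [/\ submodule A, A <> setT &
      forall B : set V, submodule B -> A `<=` B -> B = A \/ B = setT].

Definition short_exact (K M N : lmodType R) (f : K -> M) (g : M -> N) : Prop :=
  [/\ injective f, range f = kernel g & range g = setT].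

Definition projective (P : lmodType R) : Prop :=
  forall (V W : lmodType R) (g : {linear V -> W}) (f : {linear P -> W}),
    range g = setT -> exists h : {linear P -> V}, forall x, g (h x) = f x.

Definition superfluous V (B : set V) : Prop :=
  forall A : set V, submodule A ->
    (forall v, exists a b, [/\ A a, B b & v = a + b]) -> A = setT.

(* f, corestricted to the submodule A of V, is a projective cover P -> A *)
Definition projective_cover (P V : lmodType R) (f : {linear P -> V})
    (A : set V) : Prop :=
  [/\ projective P, range f = A & superfluous (kernel f)].

End Modules.

Arguments fingen {R} V.

Section Rings.
Variable R : pzRingType.

Definition jacobson : set R^o :=
  [set a | forall A : set R^o, maximal_submodule A -> A a].

(* J ^ 2 as a product of ideals *)
Definition jacobson2 : set R^o := mulIM jacobson jacobson.

(* Every left ideal is finitely generated: as all modules are left modules, no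
   chain condition on right ideals is required. *)
Definition left_noetherian : Prop :=
  forall A : set R^o, submodule A -> sub_fingen A.

Definition semiperfect : Prop :=
  forall X : lmodType R, fingen X ->
    exists (P : lmodType R) (f : {linear P -> X}),
      fingen P /\ projective_cover f setT.

End Rings.

Arguments jacobson R _ : clear implicits.
Arguments jacobson2 R _ : clear implicits.

(* A surjective algebra morphism pi : R -> S with kernel J presents S as R / J,
   with pi as the canonical projection. *)
Definition augmented (k : fieldType) (R : algType k) : Prop :=
  exists (S : algType k) (pi : {lrmorphism R -> S}),
    [/\ range pi = setT, kernel pi = jacobson R &
        exists sigma : {lrmorphism S -> R}, cancel sigma pi].

Section Resolutions.
Context {R : pzRingType}.
Implicit Types X : lmodType R.

(* The augmented complex, shifted by one: X, P 0, P 1, ... *)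
Definition term X (P : nat -> lmodType R) (n : nat) : lmodType R :=
  if n is m.+1 then P m else X.

(* A sequence ... -> P 1 -> P 0 -> X of linear maps; [diff 0] is the
   augmentation P 0 -> X. *)
Record presolution X := Presolution {
  obj : nat -> lmodType R;
  diff : forall n, {linear obj n -> term X obj n}
}.

(* Omega 0 = X, and Omega i.+1 = ker d_i, contained in P i *)
Definition syzygy X (P : presolution X) (i : nat) : set (term X (obj P) i) :=
  match i return set (term X (obj P) i) with
  | 0 => setT
  | j.+1 => kernel (diff P j)
  end.
Arguments syzygy {X} P i _.

(* Exactness and projectivity of the terms are part of the projective cover
   conditions P 0 -> X and P n.+1 -> ker d_n. *)
Definition minimal_resolution X (P : presolution X) : Prop :=
  forall n, projective_cover (diff P n) (syzygy P n).

Definition quasi_koszul X : Prop :=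
  fingen X /\
  exists P : presolution X, minimal_resolution P /\
    forall n, let Z := kernel (diff P n) in
      Z `<=` mulIM (jacobson R) setT /\
      mulIM (jacobson R) Z = Z `&` mulIM (jacobson2 R) setT.

(* A degreewise map from P to Q, extended by f : X -> Y in shifted degree 0 *)
Definition term_map X Y (P : presolution X) (Q : presolution Y)
    (f : {linear X -> Y}) (u : forall n, {linear obj P n -> obj Q n}) (n : nat) :
    {linear term X (obj P) n -> term Y (obj Q) n} :=
  match n return {linear term X (obj P) n -> term Y (obj Q) n} with
  | 0 => f
  | m.+1 => u m
  end.

Definition chain_map_over X Y (P : presolution X) (Q : presolution Y)
    (f : {linear X -> Y}) (u : forall n, {linear obj P n -> obj Q n}) : Prop :=
  forall n x, diff Q n (u n x) = term_map f u n (diff P n x).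

Definition horseshoe_diagram (K M N : lmodType R)
    (f : {linear K -> M}) (g : {linear M -> N})
    (P : presolution K) (L : presolution M) (Q : presolution N)
    (u : forall n, {linear obj P n -> obj L n})
    (v : forall n, {linear obj L n -> obj Q n}) : Prop :=
  [/\ minimal_resolution P, minimal_resolution L, minimal_resolution Q,
      chain_map_over f u /\ chain_map_over g v &
      forall n, short_exact (u n) (v n)].

Definition minimal_horseshoe (K M N : lmodType R)
    (f : {linear K -> M}) (g : {linear M -> N}) : Prop :=
  forall (P : presolution K) (Q : presolution N),
    minimal_resolution P -> minimal_resolution Q ->
    exists (L : presolution M) (u : forall n, {linear obj P n -> obj L n})
           (v : forall n, {linear obj L n -> obj Q n}),
      horseshoe_diagram f g u v.

(* J^2 Omega^i(K) = Omega^i(K) `&` J^2 Omega^i(M) for all i, where Omega^i(K)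
   is identified with its image in Omega^i(M) under the diagram. *)
Definition square_radical_compatible (K M : lmodType R) (f : {linear K -> M})
    (P : presolution K) (L : presolution M)
    (u : forall n, {linear obj P n -> obj L n}) : Prop :=
  forall i,
    term_map f u i @` mulIM (jacobson2 R) (syzygy P i) =
    (term_map f u i @` syzygy P i) `&` mulIM (jacobson2 R) (syzygy L i).

End Resolutions.

Arguments syzygy {R X} P i _.

Arguments quasi_koszul {R} X.

(* Main.v *)
From HB Require Import structures.
Require Import Defs.

(* Minimality makes every syzygy Z = ker d_n superfluous in the projective P_n,
   hence contained in JP_n, so only the inclusion of Z `&` J^2 P_n in JZ matters;
   as minimal resolutions are unique up to isomorphism, it may be tested on the
   resolutions of any horseshoe diagram 0 -> P -> L -> Q -> 0, whose rows split
   degreewise.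
   (1) If x lies in Omega(K) `&` J^2 P_n, then x = d l with l in J L_{n+1};
   writing also x = d p with p in P_{n+1}, the difference p - l is a cycle, hence
   in J L_{n+1}, and p lies in J P_{n+1} since P_{n+1} splits off.
   (2) If x lies in Omega(N) `&` J^2 Q_n, lift it to y in Omega(M) and to z in
   J^2 L_n, so that y - z comes from some p in P_n.  Then d p = - d z lies in
   Omega(K) `&` J^2 Omega(M) = J^2 Omega(K), hence d p = d p' with p' in J^2 P_n,
   and y - (p - p') = z + p' is a lift of x in Omega(M) `&` J^2 L_n = J Omega(M). *)

Set Implicit Arguments.
Unset Strict Implicit.
Unset Printing Implicit Defensive.

Import GRing.Theory.
Local Open Scope classical_set_scope.
Local Open Scope ring_scope.

(** * Submodules regarded as modules *)

Section SubmoduleType.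
Variables (R : pzRingType) (V : lmodType R) (A : set V) (hA : submodule A).

(* The phantom proof argument is what instance inference recovers closure from. *)
Definition submod_pred of submodule A : {pred V} := mem A.

HB.instance Definition _ := GRing.isSubmodClosed.Build R V (submod_pred hA)
  (GRing.submod_closed_semi hA).

Definition submod_type := {v : V | v \in submod_pred hA}.

HB.instance Definition _ := [isSub of submod_type for @sval _ _].
HB.instance Definition _ := [Choice of submod_type by <:].
HB.instance Definition _ := [SubChoice_isSubLmodule of submod_type by <:].

(** Needed because [projective] and [semiperfect] speak of modules, not of subsets of a module. *)
Lemma submodule_inclusion :
  exists (W : lmodType R) (i : {linear W -> V}), injective i /\ range i = A.
Proof.
exists submod_type, (val : {linear submod_type -> V}).
split; first exact: val_inj.
apply/seteqP; split => [_ [w _ <-]|v Av].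
  exact: (set_mem (valP w)).
by exists (Sub v (mem_set Av)); rewrite ?SubK.
Qed.

End SubmoduleType.

(** * Finite generation, lifting and projective covers of submodules *)

Section Submodules.
Variable R : pzRingType.
Implicit Types U V W P : lmodType R.

Lemma submoduleP V (A : set V) :
  submodule A <->
  [/\ A 0, forall x y, A x -> A y -> A (x + y) & forall c x, A x -> A (c *: x)].
Proof.
split=> [[A0 Al]|[A0 AD AZ]].
  have AZD c x y : A x -> A y -> A (c *: x + y).
    by move=> /mem_set Ax /mem_set Ay; exact: set_mem (Al c x y Ax Ay).
  split=> [|x y Ax Ay|c x Ax]; first exact: set_mem A0.
    by rewrite -[x]scale1r; exact: AZD.
  by rewrite -[c *: x]addr0; apply: AZD => //; exact: set_mem A0.
split; first exact: mem_set.
by move=> c x y /set_mem Ax /set_mem Ay; apply/mem_set/AD => //; exact: AZ.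
Qed.

Lemma submoduleB V (A : set V) x y : submodule A -> A x -> A y -> A (x - y).
Proof.
by move=> /submoduleP[_ AD AZ] Ax Ay; rewrite -scaleN1r; apply: AD => //; exact: AZ.
Qed.

Lemma submodule_setT V : submodule [set: V].
Proof. exact/submoduleP. Qed.

Lemma submodule_kernel V W (f : {linear V -> W}) : submodule (kernel f).
Proof.
apply/submoduleP; split=> [|x y fx fy|c x fx]; rewrite /kernel /=.
- by rewrite linear0.
- by rewrite linearD fx fy addr0.
- by rewrite linearZ /= fx scaler0.
Qed.

Lemma submodule_image V W (f : {linear V -> W}) (A : set V) :
  submodule A -> submodule (f @` A).
Proof.
move=> /submoduleP[A0 AD AZ]; apply/submoduleP; split.
- by exists 0; rewrite ?linear0.
- by move=> _ _ [x Ax <-] [y Ay <-]; exists (x + y); rewrite ?linearD //; exact: AD.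
- by move=> c _ [x Ax <-]; exists (c *: x); rewrite ?linearZ //; exact: AZ.
Qed.

Lemma submodule_preimage V W (f : {linear V -> W}) (B : set W) :
  submodule B -> submodule (f @^-1` B).
Proof.
move=> /submoduleP[B0 BD BZ]; apply/submoduleP; split=> [|x y|c x] /=.
- by rewrite linear0.
- by rewrite linearD; exact: BD.
- by rewrite linearZ /=; exact: BZ.
Qed.

Lemma submoduleI V (A B : set V) :
  submodule A -> submodule B -> submodule (A `&` B).
Proof.
move=> /submoduleP[A0 AD AZ] /submoduleP[B0 BD BZ]; apply/submoduleP; split=> //.
- by move=> x y [Ax Bx] [Ay By]; split; [exact: AD | exact: BD].
- by move=> c x [Ax Bx]; split; [exact: AZ | exact: BZ].
Qed.

Lemma submodule_sum V (A : set V) n (c : 'I_n -> R) (x : 'I_n -> V) :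
  submodule A -> (forall i, A (x i)) -> A (\sum_(i < n) c i *: x i).
Proof.
move=> /submoduleP[A0 AD AZ] Ax.
by apply: (big_ind (A : V -> Prop)) => // i _; exact: AZ.
Qed.

(** The span as an intersection of submodules: membership is exploited by choosing [B], without
    handling coefficients. *)
Definition hull V (s : seq V) : set V :=
  [set v | forall B : set V, submodule B -> (forall x, x \in s -> B x) -> B v].

Lemma submodule_hull V (s : seq V) : submodule (hull s).
Proof.
apply/submoduleP; split=> [B hB _|x y sx sy B hB Bs|c x sx B hB Bs].
- by have /submoduleP[] := hB.
- by have /submoduleP[_ BD _] := hB; apply: BD; [exact: sx | exact: sy].
- by have /submoduleP[_ _ BZ] := hB; apply: BZ; exact: sx.
Qed.

Lemma mem_hull V (s : seq V) x : x \in s -> hull s x.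
Proof. by move=> sx B _; exact. Qed.

Definition lincomb V n (g : 'I_n -> V) : set V :=
  [set v | exists c : 'I_n -> R, v = \sum_(i < n) c i *: g i].

Lemma submodule_lincomb V n (g : 'I_n -> V) : submodule (lincomb g).
Proof.
apply/submoduleP; split.
- by exists (fun=> 0); rewrite big1 // => i _; rewrite scale0r.
- move=> _ _ [c ->] [d ->]; exists (fun i => c i + d i).
  by rewrite -big_split; apply: eq_bigr => i _; rewrite scalerDl.
- move=> c _ [d ->]; exists (fun i => c * d i).
  by rewrite scaler_sumr; apply: eq_bigr => i _; rewrite scalerA.
Qed.

Lemma mem_lincomb V n (g : 'I_n -> V) i : lincomb g (g i).
Proof.
exists (fun j => (j == i)%:R).
rewrite (bigD1 i) //= eqxx scale1r big1 ?addr0 // => j /negPf ->.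
by rewrite scale0r.
Qed.

Lemma sub_fingenP V (A : set V) : sub_fingen A <-> exists s, A = hull s.
Proof.
split=> [[n [g ->]]|[s ->]].
  exists (codom g); apply/seteqP; split=> [_ [c ->] B hB Bg|v].
    by apply: submodule_sum => // i; apply/Bg/codom_f.
  apply; first exact: submodule_lincomb.
  by move=> _ /codomP[i ->]; exact: mem_lincomb.
exists (size s), (tnth (in_tuple s)); apply/seteqP; split=> [v|_ [c ->]].
  apply; first exact: submodule_lincomb.
  move=> x xs; have /tnthP[i ->] : x \in in_tuple s by [].
  exact: mem_lincomb.
apply: submodule_sum => [|i]; first exact: submodule_hull.
exact: mem_hull (mem_tnth i (in_tuple s)).
Qed.


Lemma sub_fingen_injective V W (i : {linear W -> V}) :
  injective i -> sub_fingen (range i) -> fingen W.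
Proof.
move=> i_inj /sub_fingenP[s si].
have /choice[r ri] : forall x, exists w, x \in s -> i w = x.
  move=> x.
  (* Only the values on [s] matter; 0 is a dummy elsewhere. *)
  have [xs|] := boolP (x \in s); last by exists 0.
  have [w _ iw] : range i x by rewrite si; exact: mem_hull.
  by exists w.
apply/sub_fingenP; exists (map r s); apply/seteqP; split=> // w _ B hB Bs.
have [w' Bw' /i_inj <- //] : (i @` B) (i w).
have : hull s (i w) by rewrite -si; exists w.
apply; first exact: submodule_image.
by move=> x xs; exists (r x); [exact/Bs/map_f | exact: ri].
Qed.

Lemma fingen_cover P V (f : {linear P -> V}) (A : set V) :
  projective_cover f A -> sub_fingen A -> fingen P.
Proof.
move=> [_ <- f_sup] /sub_fingenP[s sf].
have /choice[r rf] : forall x, exists w, x \in s -> f w = x.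
  move=> x.
  have [xs|] := boolP (x \in s); last by exists 0.
  have [w _ iw] : range f x by rewrite sf; exact: mem_hull.
  by exists w.
apply/sub_fingenP; exists (map r s); apply/esym/f_sup.
  exact: submodule_hull.
move=> p.
have [q hq fq] : (f @` hull (map r s)) (f p).
  have : hull s (f p) by rewrite -sf; exists p.
  apply; first exact/submodule_image/submodule_hull.
  by move=> x xs; exists (r x); [exact: mem_hull (map_f r xs) | exact: rf].
exists q, (p - q); split=> //; last by rewrite subrKC.
by rewrite /kernel /= linearB fq subrr.
Qed.

(** Induction on a generating list [x :: s] of a span containing [A]. The coefficients of [x] modulo
    [hull s] in elements of [A] form a left ideal; lifts to [A] of its generators, with generators
    of [A] meet [hull s], generate [A]. *)
Lemma noetherian_submodule V (A : set V) :
  left_noetherian R -> fingen V -> submodule A -> sub_fingen A.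
Proof.
move=> noeth /sub_fingenP[s Vs] hA.
have {Vs} : A `<=` hull s by rewrite -Vs.
elim: s A hA => [|x s IHs] A hA As.
  apply/sub_fingenP; exists [::]; apply/seteqP; split=> // v.
  by apply.
have hH : submodule (hull s) by exact: submodule_hull.
have [H0 HD HZ] := (submoduleP _).1 hH.
pose coef (B : set V) : set R^o := [set r | exists2 a, B a & hull s (a - r *: x)].
have hcoef B : submodule B -> submodule (coef B).
  move=> /submoduleP[B0 BD BZ]; apply/submoduleP; split.
  - by exists 0; rewrite // scale0r subr0.
  - move=> c d [a Ba ha] [b Bb hb]; exists (a + b); first exact: BD.
    by rewrite scalerDl opprD addrACA; exact: HD.
  - move=> c d [a Ba ha]; exists (c *: a); first exact: BZ.
    by rewrite -scalerA -scalerBr; exact: HZ.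
have [t At] := (sub_fingenP _).1 (noeth _ (hcoef _ hA)).
have [|s' As'] := (sub_fingenP _).1 (IHs (A `&` hull s) (submoduleI hA hH) _).
  by move=> v [].
have /choice[y yP] : forall r, exists a, r \in t -> A a /\ hull s (a - (r : R) *: x).
  move=> r.
  have [rt|] := boolP (r \in t); last by exists 0.
  have [a Aa ha] : coef A r by rewrite At; exact: mem_hull.
  by exists a.
apply/sub_fingenP; exists (map y t ++ s'); apply/seteqP; split=> [v Av B hB Bs|v]; last first.
  apply=> // z; rewrite mem_cat => /orP[/mapP[r rt ->]|zs']; first by have [] := yP _ rt.
  have : (A `&` hull s) z by rewrite As'; exact: mem_hull.
  by case.
(* The vectors congruent to a multiple of [x] modulo [hull s] form a submodule containing
   [x :: s]. *)
have [r hr] : exists r : R, hull s (v - r *: x).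
  apply: (As v Av [set v | exists r : R, hull s (v - r *: x)]).
    apply/submoduleP; split.
    - by exists 0; rewrite scale0r subr0.
    - by move=> a b [c hc] [d hd]; exists (c + d); rewrite scalerDl opprD addrACA; exact: HD.
    - by move=> c a [d hd]; exists (c * d); rewrite -scalerA -scalerBr; exact: HZ.
  move=> z; rewrite inE => /orP[/eqP ->|zs].
    by exists 1; rewrite scale1r subrr.
  by exists 0; rewrite scale0r subr0; exact: mem_hull.
(* The coefficient ideal of the part of [A] inside [B] contains the generators [t], hence [r]. The
   resulting [b] agrees with [v] modulo [hull s], which reduces the claim to [v - b]. *)
have [b [Ab Bb] hb] : coef (A `&` B) r.
  have : hull t r by rewrite -At; exists v.
  apply; first exact/hcoef/submoduleI.
  move=> q qt; have [Ay hy] := yP _ qt; exists (y q) => //; split=> //.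
  by apply: Bs; rewrite mem_cat map_f.
rewrite -[v](subrK b) addrC; have /submoduleP[_ BD _] := hB; apply: BD => //.
have : (A `&` hull s) (v - b).
  split; first exact: submoduleB.
  have -> : v - b = (v - (r : R) *: x) - (b - (r : R) *: x) by rewrite opprB subrKA.
  exact: (submoduleB hH hr hb).
rewrite As'; apply=> // z zs; by apply: Bs; rewrite mem_cat zs orbT.
Qed.

Lemma corestriction U V W (i : {linear W -> V}) (g : {linear U -> V}) :
  injective i -> range g `<=` range i ->
  exists g' : {linear U -> W}, forall x, i (g' x) = g x.
Proof.
move=> i_inj gi.
have /choice[g' ig'] : forall x, exists w, i w = g x.
  move=> x.
  by have [|w _ iw] := gi (g x); [exists x | exists w].
have g'_lin : linear g'.
  by move=> c x y; apply: i_inj; rewrite linearP !ig' linearP.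
pose L := GRing.isLinear.Build R U W _ g' g'_lin.
by exists (HB.pack_for {linear U -> W} g' L).
Qed.

(** Projectivity is stated for surjections; corestricting both maps to the image of [g] extends it
    to any [g] whose image contains that of [f]. *)
Lemma projective_lift P V W (g : {linear V -> W}) (f : {linear P -> W}) :
  projective P -> range f `<=` range g ->
  exists h : {linear P -> V}, forall x, g (h x) = f x.
Proof.
move=> P_proj fg.
have [W' [i [i_inj ri]]] :=
  submodule_inclusion (submodule_image g (@submodule_setT V)).
have [|f' if'] := @corestriction _ _ _ i f i_inj; first by rewrite ri.
have [|g' ig'] := @corestriction _ _ _ i g i_inj; first by rewrite ri.
have [|h gh] := P_proj _ _ g' f'.
  apply/seteqP; split=> // w _.
  have [v _ gv] : range g (i w) by rewrite -ri; exists w.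
  by exists v => //; apply: i_inj; rewrite ig'.
by exists h => x; rewrite -ig' gh.
Qed.

(** A cover of [A] taken as an abstract module, followed by the inclusion into [V]; the inclusion is
    injective, so the kernel stays the same. *)
Lemma noetherian_projective_cover V (A : set V) :
  left_noetherian R -> semiperfect R -> fingen V -> submodule A ->
  exists (P : lmodType R) (f : {linear P -> V}),
    fingen P /\ projective_cover f A.
Proof.
move=> noeth sperf V_fg hA.
have [W [i [i_inj ri]]] := submodule_inclusion hA.
have W_fg : fingen W.
  by apply: sub_fingen_injective i_inj _; rewrite ri; exact: noetherian_submodule.
have [P [p [P_fg [P_proj pT p_sup]]]] := sperf W W_fg.
exists P, (i \o p); split=> //; split=> //.
  move: ri pT => <- <-; apply/seteqP; split=> [_ [x _ <-]|_ [_ [x _ <-] <-]].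
    by exists (p x) => //; exists x.
  by exists x.
suff -> : kernel (i \o p) = kernel p by [].
apply/seteqP; split=> x; rewrite /kernel /=; last by move=> ->; rewrite linear0.
by move=> ipx; apply: i_inj; rewrite ipx linear0.
Qed.

End Submodules.

(** * Products of ideals with submodules *)

Section IdealProducts.
Variable R : pzRingType.
Implicit Types (V W : lmodType R) (I : set R^o).

Lemma mulIM0 V I (A : set V) : mulIM I A 0.
Proof.
have e (T : Type) : 'I_0 -> T by case.
exists 0%N, (e _), (e _); rewrite big_ord0; split; first by case.
by split=> //; case.
Qed.

Lemma mulIMD V I (A : set V) x y : mulIM I A x -> mulIM I A y -> mulIM I A (x + y).
Proof.
move=> [m [a [v [Ia [Av ->]]]]] [n [b [w [Ib [Bw ->]]]]].
pose glue (T : Type) (s : 'I_m -> T) (t : 'I_n -> T) (i : 'I_(m + n)) :=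
  match split i with inl j => s j | inr j => t j end.
exists (m + n)%N, (glue _ a b), (glue _ v w); split; last split.
- by move=> i; rewrite /glue; case: splitP.
- by move=> i; rewrite /glue; case: splitP.
rewrite big_split_ord /glue; congr (_ + _); apply: eq_bigr => i _.
  by case: splitP => j /= ij; [rewrite (ord_inj ij) | have := ltn_ord i; rewrite ij -ltn_subRL subnn].
case: splitP => j /= ij; first by have := ltn_ord j; rewrite -ij -ltn_subRL subnn.
by move/addnI/ord_inj: ij => ->.
Qed.

Lemma mulIM_scale V I (A : set V) (a : R) x : I a -> A x -> mulIM I A (a *: x).
Proof.
by move=> Ia Ax; exists 1%N, (fun=> a), (fun=> x); rewrite big_ord1.
Qed.

(** As [I] and [A] are arbitrary sets, the sign has to be absorbed by the vectors. *)
Lemma mulIMN V I (A : set V) x : mulIM I A x -> mulIM I (-%R @` A) (- x).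
Proof.
move=> [n [a [y [Ia [Ay ->]]]]]; exists n, a, (fun i => - y i); split=> //.
split=> [i|]; first by exists (y i).
by rewrite raddf_sum; apply: eq_bigr => i _; rewrite scalerN.
Qed.

Lemma mulIM_ind V I (A B : set V) :
  B 0 -> (forall x y, B x -> B y -> B (x + y)) ->
  (forall (a : R) x, I a -> A x -> B (a *: x)) -> mulIM I A `<=` B.
Proof.
move=> B0 BD BZ _ [n [a [x [Ia [Ax ->]]]]].
by apply: (big_ind (B : V -> Prop)) => // i _; exact: BZ.
Qed.

Lemma mulIM_image V W I (f : {linear V -> W}) (A : set V) :
  f @` mulIM I A = mulIM I (f @` A).
Proof.
apply/seteqP; split=> [_ [x Ix <-]|].
  suff H : mulIM I A `<=` f @^-1` mulIM I (f @` A) by exact: H.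
  apply: mulIM_ind => [|y z|a y Ia Ay] /=.
  - by rewrite linear0; exact: mulIM0.
  - by rewrite linearD; exact: mulIMD.
  - by rewrite linearZ /=; apply: mulIM_scale => //; exists y.
apply: mulIM_ind.
- by exists 0; [exact: mulIM0 | rewrite linear0].
- by move=> _ _ [x Ax <-] [y Ay <-]; exists (x + y); [exact: mulIMD | rewrite linearD].
- move=> a _ Ia [x Ax <-]; exists (a *: x); last by rewrite linearZ.
  exact: mulIM_scale.
Qed.

Lemma mulIM_image_setT V W I (f : {linear V -> W}) x :
  mulIM I setT x -> mulIM I (range f) (f x).
Proof. by move=> Ix; rewrite -mulIM_image; exists x. Qed.

Lemma mulIM_subset V I (A B : set V) : A `<=` B -> mulIM I A `<=` mulIM I B.
Proof.
move=> AB; apply: mulIM_ind; [exact: mulIM0 | exact: mulIMD |].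
by move=> a x Ia /AB; exact: mulIM_scale.
Qed.

Lemma mulIMA_subset V I J (A : set V) : mulIM I (mulIM J A) `<=` mulIM (mulIM I J) A.
Proof.
apply: mulIM_ind; [exact: mulIM0 | exact: mulIMD |].
move=> a x Ia JAx.
suff H : mulIM J A `<=` [set x | mulIM (mulIM I J) A (a *: x)] by exact: H.
apply: mulIM_ind => /=.
- by rewrite scaler0; exact: mulIM0.
- by move=> y z; rewrite scalerDr; exact: mulIMD.
- move=> b y Jb Ay; rewrite scalerA; apply: mulIM_scale => //.
  (* The product of ideals is [mulIM] in the regular module, where scaling is multiplication. *)
  exact: (@mulIM_scale R^o).
Qed.

End IdealProducts.

Section Radical.
Variable R : pzRingType.
Implicit Types (V W P Q : lmodType R).

(** If [A] and the image of [B] fill [W], then the preimage of [A] and [B] fill [V]. So the preimage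
    is all of [V], and [A] contains the image of [B]. *)
Lemma superfluous_image V W (f : {linear V -> W}) (B : set V) :
  superfluous B -> superfluous (f @` B).
Proof.
move=> B_sup A hA AB.
have fA : f @^-1` A = setT.
  apply: B_sup; first exact: submodule_preimage.
  move=> v; have [a [_ [Aa [b Bb <-] fv]]] := AB (f v).
  exists (v - b), b; split=> //; last by rewrite subrK.
  by rewrite /= linearB fv addrK.
apply/seteqP; split=> // w _; have [a [_ [Aa [b Bb <-] ->]]] := AB w.
have /submoduleP[_ AD _] := hA; apply: AD => //.
by have : (f @^-1` A) b by rewrite fA.
Qed.

(** A maximal left ideal [m] not containing [B] would satisfy m + B = R, against superfluity of
    [B]. *)
Lemma superfluous_jacobson (B : set R^o) :
  submodule B -> superfluous B -> B `<=` jacobson R.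
Proof.
move=> hB B_sup b Bb m [hm m_proper m_max].
have /submoduleP[m0 mD mZ] := hm; have /submoduleP[B0 BD BZ] := hB.
pose C : set R^o := [set x | exists a b, [/\ m a, B b & x = a + b]].
have hC : submodule C.
  apply/submoduleP; split.
  - by exists 0, 0; rewrite addr0.
  - move=> _ _ [a [c [ma Bc ->]]] [a' [c' [ma' Bc' ->]]].
    by exists (a + a'), (c + c'); split; [exact: mD | exact: BD | rewrite addrACA].
  - move=> r _ [a [c [ma Bc ->]]].
    by exists (r *: a), (r *: c); split; [exact: mZ | exact: BZ | rewrite scalerDr].
have mC : m `<=` C by move=> a ma; exists a, 0; rewrite addr0.
case: (m_max C hC mC) => [<-|CT]; first by exists 0, b; rewrite add0r.
case: m_proper; apply: B_sup => // x.
by have : C x by rewrite CT.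
Qed.

(* A section of a free cover of P provides coordinate functionals; they send a
   superfluous submodule to superfluous left ideals. *)
Lemma superfluous_radical P (B : set P) :
  projective P -> fingen P -> submodule B -> superfluous B ->
  B `<=` mulIM (jacobson R) setT.
Proof.
move=> P_proj [n [e Pe]] hB B_sup.
pose ev (c : {ffun 'I_n -> R^o}) : P := \sum_(i < n) (c i : R) *: e i.
have ev_lin : linear ev.
  move=> r c d; rewrite /ev scaler_sumr -big_split; apply: eq_bigr => i _.
  by rewrite !ffunE scalerDl scalerA.
pose EV := HB.pack_for {linear {ffun 'I_n -> R^o} -> P} ev
  (GRing.isLinear.Build R _ P _ ev ev_lin).
have [|h evh] := P_proj _ _ EV idfun.
  apply/seteqP; split=> // p _.
  have [c ->] : lincomb e p by rewrite /lincomb -Pe.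
  by exists [ffun i => c i] => //; apply: eq_bigr => i _; rewrite ffunE.
move=> b Bb; rewrite -[b]evh.
exists n, (fun i => h b i), e; split=> // i.
pose co (p : P) : R^o := h p i.
have co_lin : linear co by move=> r p q; rewrite /co linearP !ffunE.
pose CO := HB.pack_for {linear P -> R^o} co
  (GRing.isLinear.Build R P R^o _ co co_lin).
apply: (@superfluous_jacobson (CO @` B)).
- exact: submodule_image.
- exact: superfluous_image.
- by exists b.
Qed.

(** A section [s] of [v] makes [l - s (v l)] a retraction of [W] onto the image of [u], and linear
    maps preserve multiples by [I]. *)
Lemma split_mono_mulIM P W Q (u : {linear P -> W}) (v : {linear W -> Q})
    (I : set R^o) (p : P) :
  short_exact u v -> projective Q ->
  mulIM I setT (u p) -> mulIM I setT p.
Proof.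
move=> [u_inj uv vT] Q_proj Iup.
have [s vs] := Q_proj _ _ v idfun vT.
have vu x : v (u x) = 0.
  by have : kernel v (u x) by rewrite -uv; exists x.
suff H : mulIM I setT `<=` [set l | exists2 p', mulIM I setT p' & u p' = l - s (v l)].
  have /= [p' Ip'] := H _ Iup.
  by rewrite vu (linear0 s) subr0 => /u_inj <-.
apply: mulIM_ind => /=.
- by exists 0; [exact: mulIM0 | rewrite !linear0 addr0].
- move=> x y [a Ia ua] [b Ib ub]; exists (a + b); first exact: mulIMD.
  by rewrite !linearD /= ua ub addrACA.
- move=> a x Ia _.
  have [q _ uq] : range u (x - s (v x)) by rewrite uv /kernel /= linearB vs subrr.
  exists (a *: q); first exact: mulIM_scale.
  by rewrite !linearZ /= uq scalerDr scalerN.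
Qed.

(** Uniqueness of projective covers. The conclusion on kernels has the shape of the hypothesis on
    [h], so the lemma can be iterated along a resolution. *)
Lemma projective_cover_lift P P' V V' (f : {linear P -> V}) (f' : {linear P' -> V'})
    (A : set V) (A' : set V') (h : {linear V -> V'}) :
  projective_cover f A -> projective_cover f' A' -> injective h -> h @` A = A' ->
  exists g : {linear P -> P'}, injective g /\ g @` kernel f = kernel f'.
Proof.
move=> [P_proj fA f_sup] [P'_proj f'A' f'_sup] h_inj hA.
have [|g f'g] := @projective_lift _ _ _ _ f' (h \o f) P_proj.
  by rewrite f'A' -hA -fA => _ [x _ <-]; exists (f x) => //; exists x.
have gT : range g = setT.
  apply: f'_sup; first exact/submodule_image/submodule_setT.
  move=> p'; have : A' (f' p') by rewrite -f'A'; exists p'.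
  rewrite -hA -fA => -[_ [p _ <-] hfp].
  exists (g p), (p' - g p); split; [by exists p | | by rewrite subrKC].
  by rewrite /kernel /= linearB f'g /= hfp subrr.
have kerE x : kernel f' (g x) <-> kernel f x.
  rewrite /kernel /= f'g /=; split=> [hfx|->]; last by rewrite linear0.
  by apply: h_inj; rewrite hfx linear0.
have [s gs] := P'_proj _ _ g idfun gT.
have sT : range s = setT.
  apply: f_sup; first exact/submodule_image/submodule_setT.
  move=> p; exists (s (g p)), (p - s (g p)); split; [by exists (g p) | | by rewrite subrKC].
  by apply/kerE; rewrite /kernel /= linearB gs subrr linear0.
exists g; split.
  move=> x y; have [x' _ <-] : range s x by rewrite sT.
  have [y' _ <-] : range s y by rewrite sT.
  by rewrite !gs /= => ->.
apply/seteqP; split=> [_ [x /kerE fx <-] //|y fy].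
by exists (s y); rewrite ?gs //; apply/kerE; rewrite gs.
Qed.

End Radical.

(** * Existence and comparison of minimal resolutions *)

Section MinimalResolutions.
Variable R : pzRingType.
Implicit Types X : lmodType R.

Lemma minimal_resolution_exists X :
  left_noetherian R -> semiperfect R -> fingen X ->
  exists P : presolution X, minimal_resolution P.
Proof.
move=> noeth sperf X_fg.
(* The target of each differential is the source of the previous one, so the recursion runs on
   arrows packed with both their modules. *)
pose arrow := {W : lmodType R & {V : lmodType R & {linear V -> W}}}.
pose src (a : arrow) := projT1 (projT2 a).
pose arr (a : arrow) : {linear src a -> projT1 a} := projT2 (projT2 a).
have cover (W : lmodType R) (A : set W) : fingen W -> submodule A ->
    {V : lmodType R & {f : {linear V -> W} | fingen V /\ projective_cover f A}}.
  move=> W_fg hA; have /cid[V /cid fP] := noetherian_projective_cover noeth sperf W_fg hA.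
  by exists V.
pose fgarrow := {a : arrow | fingen (src a)}.
have [V0 [f0 [V0_fg f0_cov]]] := cover X setT X_fg (@submodule_setT _ X).
pose next (a : fgarrow) : fgarrow :=
  let c := cover (src (sval a)) (kernel (arr (sval a))) (svalP a)
             (submodule_kernel _) in
  exist (fun a : arrow => fingen (src a))
    (existT _ _ (existT _ (projT1 c) (sval (projT2 c)))) (svalP (projT2 c)).1.
pose start : fgarrow :=
  exist (fun a : arrow => fingen (src a)) (existT _ X (existT _ V0 f0)) V0_fg.
pose chain n : fgarrow := iter n next start.
pose ob n := src (sval (chain n)).
(* The target [term X ob n] computes only once [n] is a constructor, hence the match. *)
pose df n : {linear ob n -> term X ob n} :=
  match n return {linear ob n -> term X ob n} with
  | 0 => arr (sval (chain 0))
  | m.+1 => arr (sval (chain m.+1))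
  end.
exists (Presolution df) => -[|[|n]] //=.
- exact: (svalP (projT2 (cover _ _ (svalP (chain 0)) (submodule_kernel _)))).2.
- exact: (svalP (projT2 (cover _ _ (svalP (chain n.+1)) (submodule_kernel _)))).2.
Qed.

Lemma range_diff X (P : presolution X) n :
  minimal_resolution P -> range (diff P n) = syzygy P n.
Proof. by move=> /(_ n)[]. Qed.

Lemma fingen_obj X (P : presolution X) n :
  left_noetherian R -> fingen X -> minimal_resolution P -> fingen (obj P n).
Proof.
move=> noeth X_fg P_min; elim: n => [|n IHn].
  exact: fingen_cover (P_min 0%N) X_fg.
apply: fingen_cover (P_min n.+1) _.
exact/noetherian_submodule/submodule_kernel.
Qed.

Lemma kernel_diff_radical X (P : presolution X) n :
  left_noetherian R -> fingen X -> minimal_resolution P ->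
  kernel (diff P n) `<=` mulIM (jacobson R) setT.
Proof.
move=> noeth X_fg P_min; have [P_proj _ sup] := P_min n.
by apply: superfluous_radical; [| exact: fingen_obj | exact: submodule_kernel |].
Qed.

Lemma radical_kernel_sub X (P : presolution X) n :
  left_noetherian R -> fingen X -> minimal_resolution P ->
  mulIM (jacobson R) (kernel (diff P n)) `<=`
  kernel (diff P n) `&` mulIM (jacobson2 R) setT.
Proof.
move=> noeth X_fg P_min x Jx; split.
  have /submoduleP[k0 kD kZ] := submodule_kernel (diff P n).
  by move: x Jx; apply: mulIM_ind => // a x _; exact: kZ.
apply: mulIMA_subset; apply: mulIM_subset Jx.
exact: kernel_diff_radical.
Qed.

Lemma minimal_resolution_compare X (P P' : presolution X) n :
  minimal_resolution P -> minimal_resolution P' ->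
  exists h : {linear term X (obj P) n -> term X (obj P') n},
    injective h /\ h @` syzygy P n = syzygy P' n.
Proof.
move=> P_min P'_min; elim: n => [|n [h [h_inj hE]]].
  by exists idfun; split=> //; rewrite /= image_id.
exact: projective_cover_lift (P_min n) (P'_min n) h_inj hE.
Qed.

(** [quasi_koszul] provides one good resolution. The comparison map carries J^2 into J^2 and, being
    injective, brings membership in J Z back to any other minimal resolution. *)
Lemma quasi_koszul_minimal X (P : presolution X) n :
  quasi_koszul X -> minimal_resolution P ->
  kernel (diff P n) `&` mulIM (jacobson2 R) setT `<=`
  mulIM (jacobson R) (kernel (diff P n)).
Proof.
move=> [_ [P' [P'_min P'K]]] P_min x [kx Jx].
(* In the shifted indexing, [n.+1] compares [obj P n] with [obj P' n] and matches the kernels of the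
   two [diff] maps at [n]. *)
have [h [h_inj hE]] := minimal_resolution_compare n.+1 P_min P'_min.
have : mulIM (jacobson R) (kernel (diff P' n)) (h x).
  rewrite (P'K n).2; split; first by move: hE => /= <-; exists x.
  have : (h @` mulIM (jacobson2 R) setT) (h x) by exists x.
  by rewrite mulIM_image; exact: mulIM_subset.
move: hE => /= <-; rewrite -mulIM_image => -[y Jy /h_inj <- //].
Qed.

Lemma quasi_koszulP X (P : presolution X) :
  left_noetherian R -> fingen X -> minimal_resolution P ->
  (forall n, kernel (diff P n) `&` mulIM (jacobson2 R) setT `<=`
     mulIM (jacobson R) (kernel (diff P n))) ->
  quasi_koszul X.
Proof.
move=> noeth X_fg P_min PK; split=> //; exists P; split=> // n Z; split.
  exact: kernel_diff_radical.
by apply/seteqP; split; [exact: radical_kernel_sub | exact: PK].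
Qed.

End MinimalResolutions.

(** * Transfer of quasi-Koszulity along a horseshoe diagram *)

Section Horseshoe.
Variables (R : pzRingType) (K M N : lmodType R).
Variables (f : {linear K -> M}) (g : {linear M -> N}).
Variables (P : presolution K) (L : presolution M) (Q : presolution N).
Variables (u : forall n, {linear obj P n -> obj L n}).
Variables (v : forall n, {linear obj L n -> obj Q n}).
Hypotheses (noeth : left_noetherian R) (M_fg : fingen M) (N_fg : fingen N).
Hypothesis f_inj : injective f.
Hypothesis diagram : horseshoe_diagram f g u v.
Hypothesis M_qk : quasi_koszul M.

Lemma quasi_koszul_sub : fingen K -> quasi_koszul K.
Proof.
move=> K_fg; have [P_min L_min Q_min [u_ch v_ch] ex] := diagram.
apply: (quasi_koszulP noeth K_fg P_min) => n x [kx Jx].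
have : mulIM (jacobson R) (kernel (diff L n)) (u n x).
  apply: quasi_koszul_minimal => //; split.
    by rewrite /kernel /= u_ch kx linear0.
  by apply: mulIM_subset (mulIM_image_setT (u n) Jx).
(* By exactness, J times the cycles is the image of J times the next term. *)
have -> : kernel (diff L n) = range (diff L n.+1) by rewrite range_diff.
rewrite -mulIM_image => -[l Jl dl].
have [p _ dp] : range (diff P n.+1) x by rewrite range_diff.
have Jp : mulIM (jacobson R) setT p.
  apply: (split_mono_mulIM (ex n.+1)); first by have [] := Q_min n.+1.
  rewrite -(subrK l (u n.+1 p)); apply: mulIMD => //.
  apply: (kernel_diff_radical (n := n.+1) noeth M_fg L_min).
  by rewrite /kernel /= linearB dl u_ch /= dp subrr.
have := mulIM_image_setT (diff P n.+1) Jp.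
by rewrite dp range_diff.
Qed.

Lemma quasi_koszul_quot : square_radical_compatible f u -> quasi_koszul N.
Proof.
move=> compat; have [P_min L_min Q_min [u_ch v_ch] ex] := diagram.
apply: (quasi_koszulP noeth N_fg Q_min) => n x [kx Jx].
have [_ uv vT] := ex n.
(* Lifting [x] through degree [n.+1] makes its lift [y] a boundary, hence a cycle; a direct lift
   along [v n] need not be one. *)
have [q _ dq] : range (diff Q n.+1) x by rewrite range_diff.
have [l _ vl] : range (v n.+1) q by have [_ _ ->] := ex n.+1.
pose y := diff L n.+1 l.
have vy : v n y = x by rewrite -dq -vl v_ch.
have ky : kernel (diff L n) y.
  have : range (diff L n.+1) y by exists l.
  by rewrite range_diff.
have [z Jz vz] : (v n @` mulIM (jacobson2 R) setT) x.
  by rewrite mulIM_image vT.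
have [p _ up] : range (u n) (y - z) by rewrite uv /kernel /= linearB vy vz subrr.
have dp : term_map f u n (diff P n p) = - diff L n z.
  by rewrite -u_ch up linearB ky sub0r.
(* In shifted degree 0 this map is [f] itself, above it a row of the diagram. *)
have tf_inj : injective (term_map f u n).
  by case: (n) => [//|m]; have [] := ex m.
have : (term_map f u n @` mulIM (jacobson2 R) (syzygy P n)) (term_map f u n (diff P n p)).
  rewrite compat; split.
    by exists (diff P n p) => //; rewrite -range_diff //; exists p.
  rewrite dp -linearN -range_diff //; by apply: mulIM_image_setT; apply: mulIM_subset (mulIMN Jz).
(* J^2 times the syzygy is the image of J^2 P_n, which yields [p']. *)
rewrite -range_diff // -mulIM_image => -[_ [p' Jp' <-] /tf_inj dp'].
pose w := p - p'.
have : mulIM (jacobson R) (kernel (diff L n)) (y - u n w).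
  apply: quasi_koszul_minimal => //; split.
    by rewrite /kernel /= linearB ky u_ch linearB dp' subrr !linear0 addr0.
  have -> : y - u n w = z + u n p' by rewrite linearB up /= opprD opprK opprB addrA subrKC.
  by apply: mulIMD => //; exact: mulIM_subset (mulIM_image_setT (u n) Jp').
move=> Jy.
have : (v n @` mulIM (jacobson R) (kernel (diff L n))) (v n (y - u n w)) by exists (y - u n w).
(* The correction [u n w] dies in [Q], so the new lift still lies over [x]. *)
have -> : v n (y - u n w) = x.
  have : kernel (v n) (u n w) by rewrite -uv; exists w.
  by rewrite /kernel /= => vu; rewrite (linearB (v n)) vu vy subr0.
rewrite mulIM_image; apply: mulIM_subset => _ [t kt <-].
by rewrite /kernel /= v_ch kt linear0.
Qed.

End Horseshoe.

Theorem theoremD (k : fieldType) (R : algType k)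
    (K M N : lmodType R) (f : {linear K -> M}) (g : {linear M -> N}) :
  augmented R -> left_noetherian R -> semiperfect R ->
  fingen K -> fingen M -> fingen N ->
  short_exact f g -> minimal_horseshoe f g ->
  (quasi_koszul M -> quasi_koszul K) /\
  (forall (P : presolution K) (L : presolution M) (Q : presolution N)
          (u : forall n, {linear obj P n -> obj L n})
          (v : forall n, {linear obj L n -> obj Q n}),
     horseshoe_diagram f g u v ->
     square_radical_compatible f u ->
     quasi_koszul K -> quasi_koszul M -> quasi_koszul N).
Proof.
move=> _ noeth sperf K_fg M_fg N_fg [f_inj _ _] horseshoe; split=> [M_qk|].
  (* The horseshoe property only acts on given resolutions of [K] and [N], so these are constructed
     first. *)
  have [P P_min] := minimal_resolution_exists noeth sperf K_fg.
  have [Q Q_min] := minimal_resolution_exists noeth sperf N_fg.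
  have [L [u [v diagram]]] := horseshoe P Q P_min Q_min.
  exact: quasi_koszul_sub diagram M_qk K_fg.
move=> P L Q u v diagram compat _ M_qk.
exact: quasi_koszul_quot diagram M_qk compat.
Qed.
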